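(* Let $n\ge4$, let $\epsilon_0,\dots,\epsilon_{n-1}$ be the standard basis of $\mathbb{R}^n$, and let $\mathbf j=\sum_{i=0}^{n-1}\epsilon_i$. Let $\Psi$ be the set of $2^n$ vectors of the form $(\pm2,\dots,\pm2)\in\mathbb{R}^n$, and let $\Psi_D^+$ (respectively $\Psi_D^-$) be the subset of those vectors containing an even (respectively odd) number of entries equal to $-2$. Let $\Delta_D=\{\alpha_0,\alpha_1,\dots,\alpha_{n-1},\alpha'_n\}$, where $\alpha_0=-4(\epsilon_0+\epsilon_1)$, $\alpha_i=4(\epsilon_{i-1}-\epsilon_i)$ for $0<i<n$, and $\alpha'_n=4(\epsilon_{n-2}+\epsilon_{n-1})$. (i) Each of the $2^{n-1}$-dimensional $\mathbb{C}$-vector spaces $V_{\Psi_D^+}$ and $V_{\Psi_D^-}$ has the structure of a $\mathfrak g$-module (via the operators $E_{\mathbf a},F_{\mathbf a},H_{\mathbf a}$, $\mathbf a\in\Delta_D$), where $\mathfrak g$ is the derived affine Kac--Moody algebra of type $D_n^{(1)}$. (ii) Let $\Psi^\pm=\Psi_D^\pm$ and $\Delta^\pm=\Delta_D\setminus\{\alpha_0\}$. Then each of the two sets $\Psi^\pm$ is a minuscule system with respect to the simple system $\Delta^\pm$ respectively, and each of the two spaces $V_{\Psi^\pm}$ is a module for the simple Lie algebra $\mathfrak d_n$ over $\mathbb{C}$ of type $D_n$. The modules are nonisomorphic and both irreducible, and they afford the two spin representations of $\mathfrak d_n$. The highest weight vector of $V_{\Psi^+}$ (respectively $V_{\Psi^-}$)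 is $b_{2\mathbf j}$ (respectively $b_{2\mathbf j-4\epsilon_{n-1}}$). The lowest weight vectors of the two modules $V_{\Psi^\pm}$ are $b_{-2\mathbf j}$ and $b_{-2\mathbf j+4\epsilon_{n-1}}$, where the assignment of vectors to modules depends on whether $n$ is even or odd.
   Context: Minuscule systems: $\mathbb{R}^n$ carries the usual scalar product. Let $\Psi,\Delta\subset\mathbb{R}^n$ with $0\notin\Delta$. $\Psi$ is a minuscule system with respect to the simple system $\Delta$ if for every $\mathbf v\in\Psi$ and $\mathbf a\in\Delta$: (i) $2\,\mathbf v\cdot\mathbf a = c\,\mathbf a\cdot\mathbf a$ for some $c=c(\mathbf v,\mathbf a)\in\{-1,0,1\}$; (ii) $\mathbf v+\mathbf a\in\Psi$ if and only if $c=-1$, and $\mathbf v-\mathbf a\in\Psi$ if and only if $c=1$. Operators: $V_\Psi$ is the vector space (here over $\mathbb{C}$) with basis $\{b_{\mathbf v}:\mathbf v\in\Psi\}$. For $\mathbf a\in\Delta$ the linear endomorphisms $E_{\mathbf a},F_{\mathbf a},H_{\mathbf a}$ of $V_\Psi$ are defined by: $E_{\mathbf a}(b_{\mathbf v})=b_{\mathbf v+\mathbf a}$ if $\mathbf v+\mathbf a\in\Psi$ and $0$ otherwise; $F_{\mathbf a}(b_{\mathbf v})=b_{\mathbf v-\mathbf a}$ if $\mathbf v-\mathbf a\in\Psi$ and $0$ otherwise; $H_{\mathbf a}(b_{\mathbf v})=c(\mathbf v,\mathbf a)\,b_{\mathbf v}$. Lie algebras: the generalized Cartan matrix of $\Delta$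 is $A_{\mathbf a,\mathbf b}=2\frac{\mathbf a\cdot\mathbf b}{\mathbf a\cdot\mathbf a}$ ($\mathbf a,\mathbf b\in\Delta$). For a symmetrizable generalized Cartan matrix $A$, the derived Kac--Moody algebra $\mathfrak g'(A)$ is the Lie algebra over $\mathbb{C}$ generated by $e_i,f_i,h_i$ subject to $[h_i,h_j]=0$, $[h_i,e_j]=A_{ij}e_j$, $[h_i,f_j]=-A_{ij}f_j$, $[e_i,f_j]=\delta_{ij}h_i$, and, for $i\ne j$, $(\mathrm{ad}\,e_i)^{1-A_{ij}}(e_j)=0=(\mathrm{ad}\,f_i)^{1-A_{ij}}(f_j)$; when $A$ is an (indecomposable) Cartan matrix of finite type this is the simple Lie algebra of that type. All module structures asserted are those in which the matrix of the indicated simple system is a generalized Cartan matrix of the stated type (types as in Kac's book) and the generators $e_{\mathbf a},f_{\mathbf a},h_{\mathbf a}$ act by $E_{\mathbf a},F_{\mathbf a},H_{\mathbf a}$. A weight vector (simultaneous eigenvector for all $h_i$) is a highest (respectively lowest) weight vector if it is annihilated by all $e_i$ (respectively all $f_i$); such vectors in irreducible modules are understood up to nonzero scalar. The fundamental weights $\omega_i$ form the basis dual to the $h_i$, and $L(\omega_i)$ is the irreducible finite-dimensional module with highest weight $\omega_i$. The two spin representations of $\mathfrak d_n$ are $L(\omega_{n-1})$ and $L(\omega_n)$ (each of dimension $2^{n-1}$), where $\alpha_1,\dots,\alpha_{n-1},\alpha'_n$ label the simple roots $1,\dots,n$. *)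

(* Defs.v *)
From HB Require Import structures.
From mathcomp Require Import all_boot all_order all_algebra.
From mathcomp Require Import generic_quotient finmap.
From mathcomp Require Import boolp classical_sets reals.
From mathcomp Require Import complex.

Set Implicit Arguments.
Unset Strict Implicit.
Unset Printing Implicit Defensive.

Import Order.TTheory GRing.Theory Num.Theory.

Local Open Scope ring_scope.
Local Open Scope quotient_scope.

HB.mixin Record Lmodule_isLie (K : fieldType) L of GRing.Lmodule K L := {
  brk : L -> L -> L;
  brkDl : forall (a : K) x y z, brk (a *: x + y) z = a *: brk x z + brk y z;
  brkDr : forall (a : K) x y z, brk z (a *: x + y) = a *: brk z x + brk z y;
  brkxx : forall x, brk x x = 0;
  jacobi : forall x y z,
    brk x (brk y z) + brk y (brk z x) + brk z (brk x y) = 0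
}.

#[short(type="lieType")]
HB.structure Definition Lie (K : fieldType) :=
  {L of GRing.Lmodule K L & Lmodule_isLie K L}.

Record lie_rep (K : fieldType) (L : lieType K) (V : vectType K) := LieRep {
  lie_rep_fun :> {linear L -> 'End(V)};
  lie_rep_brk : forall x y, lie_rep_fun (brk x y) =
    (lie_rep_fun x \o lie_rep_fun y)%VF - (lie_rep_fun y \o lie_rep_fun x)%VF
}.

Definition irreducible_rep (K : fieldType) (L : lieType K) (V : vectType K)
    (rho : lie_rep L V) : Prop :=
  (fullv : {vspace V}) <> 0%VS /\
  forall U : {vspace V}, (forall x : L, (rho x @: U <= U)%VS) ->
    U = 0%VS \/ U = fullv.

Definition isomorphic_rep (K : fieldType) (L : lieType K) (V W : vectType K)
    (rho : lie_rep L V) (sigma : lie_rep L W) : Prop :=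
  exists2 phi : 'Hom(V, W), bijective phi &
    forall (x : L) (v : V), phi (rho x v) = sigma x (phi v).

(* Lie algebras by generators and relations: Lie words over the generators X,  *)
(* modulo the least congruence containing the Lie algebra axioms and           *)
(* identifying every word of rels with 0.                                      *)
Inductive lie_word (K X : Type) : Type :=
| LGen of X
| LZero
| LAdd of lie_word K X & lie_word K X
| LScale of K & lie_word K X
| LBrk of lie_word K X & lie_word K X.

Arguments LGen {K X}.
Arguments LZero {K X}.

HB.instance Definition _ (K X : Type) := gen_eqMixin (lie_word K X).
HB.instance Definition _ (K X : Type) := gen_choiceMixin (lie_word K X).

Section Presentation.
Variables (K : fieldType) (X : Type) (rels : lie_word K X -> Prop).
Local Notation W := (lie_word K X).

Inductive lie_cong : W -> W -> Prop :=
| LCRefl s : lie_cong s s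
| LCSym s t : lie_cong s t -> lie_cong t s
| LCTrans s t u : lie_cong s t -> lie_cong t u -> lie_cong s u
| LCAdd s s' t t' : lie_cong s s' -> lie_cong t t' ->
    lie_cong (LAdd s t) (LAdd s' t')
| LCScale a s s' : lie_cong s s' -> lie_cong (LScale a s) (LScale a s')
| LCBrk s s' t t' : lie_cong s s' -> lie_cong t t' ->
    lie_cong (LBrk s t) (LBrk s' t')
| LCAddA s t u : lie_cong (LAdd s (LAdd t u)) (LAdd (LAdd s t) u)
| LCAddC s t : lie_cong (LAdd s t) (LAdd t s)
| LCAdd0 s : lie_cong (LAdd LZero s) s
| LCAddN s : lie_cong (LAdd (LScale (- 1) s) s) LZero
| LCScaleA a b s : lie_cong (LScale a (LScale b s)) (LScale (a * b) s)
| LCScale1 s : lie_cong (LScale 1 s) s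
| LCScaleDr a s t :
    lie_cong (LScale a (LAdd s t)) (LAdd (LScale a s) (LScale a t))
| LCScaleDl a b s :
    lie_cong (LScale (a + b) s) (LAdd (LScale a s) (LScale b s))
| LCBrkl a s t u : lie_cong (LBrk (LAdd (LScale a s) t) u)
                            (LAdd (LScale a (LBrk s u)) (LBrk t u))
| LCBrkr a s t u : lie_cong (LBrk u (LAdd (LScale a s) t))
                            (LAdd (LScale a (LBrk u s)) (LBrk u t))
| LCBrkxx s : lie_cong (LBrk s s) LZero
| LCJacobi s t u :
    lie_cong (LAdd (LAdd (LBrk s (LBrk t u)) (LBrk t (LBrk u s)))
                   (LBrk u (LBrk s t))) LZero
| LCRel s : rels s -> lie_cong s LZero.

Definition lie_congb : rel W := fun s t => `[< lie_cong s t >].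

Lemma lie_congb_refl : reflexive lie_congb.
Proof. by move=> s; apply/asboolP; apply: LCRefl. Qed.

Lemma lie_congb_sym : symmetric lie_congb.
Proof. by move=> s t; apply: asbool_equiv_eq; split; apply: LCSym. Qed.

Lemma lie_congb_trans : transitive lie_congb.
Proof.
move=> t s u /asboolP st /asboolP tu.
by apply/asboolP; apply: LCTrans st tu.
Qed.

Canonical lie_congb_equiv :=
  EquivRel lie_congb lie_congb_refl lie_congb_sym lie_congb_trans.

Definition presented_lie := {eq_quot lie_congb}.
HB.instance Definition _ := Choice.on presented_lie.
HB.instance Definition _ := EqQuotient.on presented_lie.

Local Notation cls := (\pi_presented_lie).

Lemma pres_eqP s t : lie_cong s t <-> cls s = cls t.
Proof.
split=> [st|/eqmodP/asboolP //]; apply/eqmodP; exact/asboolP.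
Qed.

Lemma pres_repr s : lie_cong (repr (cls s)) s.
Proof. by apply/pres_eqP; rewrite reprK. Qed.

Definition pres_zero : presented_lie := cls LZero.
Definition pres_add (x y : presented_lie) : presented_lie :=
  cls (LAdd (repr x) (repr y)).
Definition pres_scale (a : K) (x : presented_lie) : presented_lie :=
  cls (LScale a (repr x)).
Definition pres_opp (x : presented_lie) : presented_lie := pres_scale (- 1) x.
Definition pres_brk (x y : presented_lie) : presented_lie :=
  cls (LBrk (repr x) (repr y)).

Lemma pres_addE s t : pres_add (cls s) (cls t) = cls (LAdd s t).
Proof. by apply/pres_eqP; apply: LCAdd; apply: pres_repr. Qed.

Lemma pres_scaleE a s : pres_scale a (cls s) = cls (LScale a s).
Proof. by apply/pres_eqP; apply: LCScale; apply: pres_repr. Qed.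

Lemma pres_brkE s t : pres_brk (cls s) (cls t) = cls (LBrk s t).
Proof. by apply/pres_eqP; apply: LCBrk; apply: pres_repr. Qed.

Lemma pres_addA : associative pres_add.
Proof.
elim/quotW=> s; elim/quotW=> t; elim/quotW=> u.
rewrite (pres_addE t u) (pres_addE s t) (pres_addE s) (pres_addE _ u).
by apply/pres_eqP; apply: LCAddA.
Qed.

Lemma pres_addC : commutative pres_add.
Proof.
elim/quotW=> s; elim/quotW=> t.
rewrite (pres_addE s t) (pres_addE t s).
by apply/pres_eqP; apply: LCAddC.
Qed.

Lemma pres_add0 : left_id pres_zero pres_add.
Proof. by elim/quotW=> s; rewrite pres_addE; apply/pres_eqP; apply: LCAdd0. Qed.

Lemma pres_addN : left_inverse pres_zero pres_opp pres_add.
Proof.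
elim/quotW=> s; rewrite /pres_opp pres_scaleE pres_addE.
by apply/pres_eqP; apply: LCAddN.
Qed.

HB.instance Definition _ := GRing.isZmodule.Build presented_lie
  pres_addA pres_addC pres_add0 pres_addN.

Lemma pres_scaleA a b x :
  pres_scale a (pres_scale b x) = pres_scale (a * b) x.
Proof.
elim/quotW: x => s.
rewrite (pres_scaleE b s) (pres_scaleE a) (pres_scaleE (a * b)).
by apply/pres_eqP; apply: LCScaleA.
Qed.

Lemma pres_scale1 : left_id 1 pres_scale.
Proof.
by elim/quotW=> s; rewrite pres_scaleE; apply/pres_eqP; apply: LCScale1.
Qed.

Lemma pres_scaleDr : right_distributive pres_scale +%R.
Proof.
move=> a; elim/quotW=> s; elim/quotW=> t.
rewrite /GRing.add /= (pres_addE s t) !(pres_scaleE a) pres_addE.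
by apply/pres_eqP; apply: LCScaleDr.
Qed.

Lemma pres_scaleDl x : {morph pres_scale^~ x : a b / a + b}.
Proof.
move=> a b; elim/quotW: x => s.
rewrite [in RHS]/GRing.add /= !pres_scaleE pres_addE.
by apply/pres_eqP; apply: LCScaleDl.
Qed.

HB.instance Definition _ := GRing.Zmodule_isLmodule.Build K presented_lie
  pres_scaleA pres_scale1 pres_scaleDr pres_scaleDl.

Lemma cls0 : cls LZero = 0. Proof. by []. Qed.
Lemma clsD s t : cls (LAdd s t) = cls s + cls t.
Proof. by rewrite -pres_addE. Qed.
Lemma clsZ a s : cls (LScale a s) = a *: cls s.
Proof. by rewrite -pres_scaleE. Qed.

Lemma pres_brkl a x y z :
  pres_brk (a *: x + y) z = a *: pres_brk x z + pres_brk y z.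
Proof.
elim/quotW: x => s; elim/quotW: y => t; elim/quotW: z => u.
rewrite -clsZ -clsD !pres_brkE -clsZ -clsD.
by apply/pres_eqP; apply: LCBrkl.
Qed.

Lemma pres_brkr a x y z :
  pres_brk z (a *: x + y) = a *: pres_brk z x + pres_brk z y.
Proof.
elim/quotW: x => s; elim/quotW: y => t; elim/quotW: z => u.
rewrite -clsZ -clsD !pres_brkE -clsZ -clsD.
by apply/pres_eqP; apply: LCBrkr.
Qed.

Lemma pres_brkxx x : pres_brk x x = 0.
Proof.
by elim/quotW: x => s; rewrite pres_brkE -cls0; apply/pres_eqP; apply: LCBrkxx.
Qed.

Lemma pres_jacobi x y z :
  pres_brk x (pres_brk y z) + pres_brk y (pres_brk z x)
    + pres_brk z (pres_brk x y) = 0.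
Proof.
elim/quotW: x => s; elim/quotW: y => t; elim/quotW: z => u.
rewrite (pres_brkE t u) (pres_brkE u s) (pres_brkE s t).
rewrite (pres_brkE s) (pres_brkE t) (pres_brkE u) -!clsD -cls0.
by apply/pres_eqP; apply: LCJacobi.
Qed.

HB.instance Definition _ := Lmodule_isLie.Build K presented_lie
  pres_brkl pres_brkr pres_brkxx pres_jacobi.

Definition pres_gen (x : X) : presented_lie := cls (LGen x).

End Presentation.

Inductive km_gen (I : Type) : Type := GE of I | GF of I | GH of I.

Section KacMoody.
Variables (K : fieldType) (m : nat) (A : 'M[int]_m).
Local Notation W := (lie_word K (km_gen 'I_m)).

Definition lie_sub (s t : W) : W := LAdd s (LScale (- 1) t).
Definition lie_ad (p : nat) (s t : W) : W := iter p (LBrk s) t.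

(* For a generalized Cartan matrix, 1 - A i j is positive when i != j, so the *)
(* absolute value only converts it to nat.                                    *)
Inductive km_rel : W -> Prop :=
| KM_HH i j : km_rel (LBrk (LGen (GH i)) (LGen (GH j)))
| KM_HE i j : km_rel (lie_sub (LBrk (LGen (GH i)) (LGen (GE j)))
                              (LScale (A i j)%:~R (LGen (GE j))))
| KM_HF i j : km_rel (lie_sub (LBrk (LGen (GH i)) (LGen (GF j)))
                              (LScale (- (A i j)%:~R) (LGen (GF j))))
| KM_EF i j : km_rel (lie_sub (LBrk (LGen (GE i)) (LGen (GF j)))
                              (LScale (i == j)%:R (LGen (GH i))))
| KM_EE i j : i != j ->
    km_rel (lie_ad `|1 - A i j|%N (LGen (GE i)) (LGen (GE j)))
| KM_FF i j : i != j ->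
    km_rel (lie_ad `|1 - A i j|%N (LGen (GF i)) (LGen (GF j))).

(* The derived algebra g'(A). For A of finite type, e.g. cartan_D n, this is   *)
(* Serre's presentation of the simple Lie algebra of that type.               *)
Definition kac_moody : lieType K := presented_lie km_rel.

Definition km_e (i : 'I_m) : kac_moody := pres_gen km_rel (GE i).
Definition km_f (i : 'I_m) : kac_moody := pres_gen km_rel (GF i).
Definition km_h (i : 'I_m) : kac_moody := pres_gen km_rel (GH i).

Variables (V : vectType K) (rho : lie_rep kac_moody V).

(* A weight is given by its values on the h_i. *)
Definition has_weight (w : 'I_m -> K) (v : V) : Prop :=
  forall i, rho (km_h i) v = w i *: v.

Definition weight_vector (v : V) : Prop :=
  v <> 0 /\ exists w, has_weight w v.

Definition highest_weight_vector (v : V) : Prop :=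
  weight_vector v /\ forall i, rho (km_e i) v = 0.

Definition lowest_weight_vector (v : V) : Prop :=
  weight_vector v /\ forall i, rho (km_f i) v = 0.

(* V is finite-dimensional, being a vectType: this says that V is L(w). *)
Definition affords_L (w : 'I_m -> K) : Prop :=
  irreducible_rep rho /\ exists2 v, highest_weight_vector v & has_weight w v.

End KacMoody.

(* Dynkin diagrams with the labels of Kac's book: D_n has nodes 1, ..., n with *)
(* n-2 joined to both n-1 and n; D_n^(1) has the extra node 0, joined to 2.    *)
Definition D_edge (n i j : nat) : bool :=
  [&& 0 < i, i <= n - 2 & j == i.+1]%N || ((i == n - 2) && (j == n))%N.

Definition D1_edge (n i j : nat) : bool :=
  D_edge n i j || ((i == 0) && (j == 2))%N.

Definition simply_laced_entry (e : rel nat) (i j : nat) : int :=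
  if i == j then 2 else if e i j || e j i then - 1 else 0.

(* Row and column i : 'I_n carry the label i + 1. *)
Definition cartan_D (n : nat) : 'M[int]_n :=
  \matrix_(i, j) simply_laced_entry (D_edge n) i.+1 j.+1.

Definition cartan_D1 (n : nat) : 'M[int]_n.+1 :=
  \matrix_(i, j) simply_laced_entry (D1_edge n) i j.

(* The fundamental weight of the node of D_n with label k, 1 <= k <= n. *)
Definition fund_weight (K : fieldType) (n k : nat) : 'I_n -> K :=
  fun i => (i.+1 == k)%:R.

Section Minuscule.
Variables (R : realType) (n : nat).
Implicit Types (v a : 'rV[R]_n).

Definition dot v a : R := \sum_(i < n) v 0 i * a 0 i.

Definition minuscule_system (Psi Delta : set 'rV[R]_n) : Prop :=
  ~ Delta 0 /\
  forall v a, Psi v -> Delta a ->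
    exists c : R, [/\ c = - 1 \/ c = 0 \/ c = 1,
      2 * dot v a = c * dot a a,
      Psi (v + a) <-> c = - 1 &
      Psi (v - a) <-> c = 1].

(* For v in Psi and a in Delta this is the c of minuscule_system. *)
Definition wcoef v a : R := 2 * dot v a / dot a a.

(* alpha labels the simple system Delta without repetition, and A is the matrix *)
(* of Delta in this labelling.                                                  *)
Definition simple_system_labelled (m : nat) (Delta : set 'rV[R]_n)
    (alpha : 'I_m -> 'rV[R]_n) (A : 'M[int]_m) : Prop :=
  [/\ injective alpha, Delta = range alpha &
      forall i j, wcoef (alpha j) (alpha i) = (A i j)%:~R].

Variable Psi : {fset 'rV[R]_n}.

Definition VPsi : Type := {ffun Psi -> (R[i])^o}.
HB.instance Definition _ := Vector.on VPsi.

(* The basis vector b_w if w is in Psi, and 0 otherwise. *)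
Definition bvec (w : 'rV[R]_n) : VPsi := [ffun u : Psi => (val u == w)%:R].

Definition lin_ext (g : Psi -> VPsi) (x : VPsi) : VPsi :=
  \sum_(u : Psi) (x u : R[i]) *: g u.

Lemma lin_ext_is_linear g : linear (lin_ext g).
Proof.
move=> a x y; rewrite /lin_ext scaler_sumr -big_split /=.
by apply: eq_bigr => u _; rewrite !ffunE scalerDl scalerA.
Qed.

HB.instance Definition _ g :=
  GRing.isLinear.Build R[i] VPsi VPsi *:%R (lin_ext g) (lin_ext_is_linear g).

Definition opE a : 'End(VPsi) := linfun (lin_ext (fun u =>
  if val u + a \in Psi then bvec (val u + a) else 0)).

Definition opF a : 'End(VPsi) := linfun (lin_ext (fun u =>
  if val u - a \in Psi then bvec (val u - a) else 0)).

Definition opH a : 'End(VPsi) := linfun (lin_ext (fun u =>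
  ((wcoef (val u) a)%:C)%C *: bvec (val u))).

Definition acts_by_operators (m : nat) (A : 'M[int]_m)
    (rho : lie_rep (kac_moody R[i] A) VPsi) (alpha : 'I_m -> 'rV[R]_n) : Prop :=
  forall i, [/\ rho (km_e R[i] A i) = opE (alpha i),
                rho (km_f R[i] A i) = opF (alpha i) &
                rho (km_h R[i] A i) = opH (alpha i)].

End Minuscule.

Section TypeD.
Variables (R : realType) (n : nat).

Definition eps (k : nat) : 'rV[R]_n := \row_(j < n) (val j == k)%:R.

Definition jvec : 'rV[R]_n := \sum_(i < n) eps i.

Definition Psi_cube : {fset 'rV[R]_n} :=
  [fset v in [seq (\row_i (if s i then - 2 else 2) : 'rV[R]_n)
             | s : {ffun 'I_n -> bool}]]%fset.

Lemma Psi_cubeP (v : 'rV[R]_n) :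
  v \in Psi_cube <-> forall i, v 0 i = 2 \/ v 0 i = - 2.
Proof.
rewrite inE /=; split=> [/mapP[s _ ->] i|H].
  by rewrite mxE; case: (s i); [right | left].
apply/mapP; exists [ffun i => v 0 i == - 2]; rewrite ?mem_enum //.
apply/rowP=> i; rewrite mxE ffunE; case: eqP => //.
by case: (H i).
Qed.

Definition num_neg (v : 'rV[R]_n) : nat := #|[set i | v 0 i == - 2]|.

Definition PsiD_plus : {fset 'rV[R]_n} :=
  [fset v in Psi_cube | ~~ odd (num_neg v)]%fset.

Definition PsiD_minus : {fset 'rV[R]_n} :=
  [fset v in Psi_cube | odd (num_neg v)]%fset.

(* alphaD n is the vector alpha'_n; the vectors alpha_k have k < n. *)
Definition alphaD (k : nat) : 'rV[R]_n :=
  if k == 0%N then - 4 *: (eps 0 + eps 1)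
  else if (k < n)%N then 4 *: (eps (k - 1) - eps k)
  else 4 *: (eps (n - 2) + eps (n - 1)).

Definition DeltaD : set 'rV[R]_n :=
  [set alphaD k | k in [set k : nat | (k <= n)%N]]%classic.

Definition DeltaD_fin : set 'rV[R]_n := (DeltaD `\ alphaD 0)%classic.

Definition node_D1 : 'I_n.+1 -> 'rV[R]_n := fun i => alphaD i.
Definition node_D : 'I_n -> 'rV[R]_n := fun i => alphaD i.+1.

End TypeD.

Arguments eps : clear implicits.
Arguments jvec : clear implicits.
Arguments Psi_cube : clear implicits.
Arguments PsiD_plus : clear implicits.
Arguments PsiD_minus : clear implicits.
Arguments alphaD : clear implicits.
Arguments DeltaD : clear implicits.
Arguments DeltaD_fin : clear implicits.
Arguments node_D1 : clear implicits.
Arguments node_D : clear implicits.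

(* Main.v *)
From HB Require Import structures.
Require Import Defs.
From mathcomp Require Import all_boot all_order all_algebra.
From mathcomp Require Import generic_quotient.
From mathcomp Require Import finmap boolp classical_sets reals complex.
From mathcomp Require Import zify ring lra.

(** The operators of a minuscule system satisfy the Kac-Moody relations for a
    purely combinatorial reason. For v in Psi the coefficient c(v, a) decides
    whether v + a or v - a lies in Psi, and c(v + b, a) = c(v, a) + A_(a,b).
    Hence a product of operators survives on b_v only if a few coefficients
    have prescribed values in {-1, 0, 1}. This gives [E_a, F_a] = H_a,
    [E_a, F_b] = 0 (comm_E_E_eq0, applied to a and -b), and the Serre
    relations, since E_a^2 = 0 and E_a E_b E_a = 0 unless A_(a,b) = -2
    (serre_E). The argument works for any generalized Cartan matrix
    (minuscule_kac_moody_rep) and so covers both D_n^(1) and D_n.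

    Every vector of Delta_D has exactly two nonzero entries, each of absolute
    value 4. Adding such a vector to a vector of the cube stays in the cube
    exactly when it changes the sign of both entries, which preserves the
    parity of the number of negative entries; so each half cube is minuscule
    (signed_pair_minuscule).

    Irreducibility and the determination of the extremal vectors rest on a
    single combinatorial fact: each half cube has only one element to which no
    simple root of D_n can be added (half_cube_sole_maximal). A vector killed
    by all E_a is then a multiple of the basis vector of that element
    (opE_killed). A nonzero submodule contains such a vector, because applying
    an E_a raises the support with respect to a positive linear form, and
    from it the F_a produce the whole basis (invariant_full). The highest
    weights of the two modules are the fundamental weights of the last two
    nodes, so the modules are not isomorphic. Lowest weight vectors are treated
    by the same lemma for the opposite simple system, negation of vectors
    exchanging the two half cubes exactly when n is odd. *)

Set Implicit Arguments.
Unset Strict Implicit.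
Unset Printing Implicit Defensive.

Import Order.TTheory GRing.Theory Num.Theory.

Local Open Scope ring_scope.

(** * Representations of a presented Lie algebra *)

Section Presentation.
Variables (K : fieldType) (V : vectType K).

(** The commutator of endomorphisms, the bracket of gl(V). *)
Definition lie_comm (f g : 'End(V)) : 'End(V) := ((f \o g) - (g \o f))%VF.

Lemma lie_commDl a f g h :
  lie_comm (a *: f + g) h = a *: lie_comm f h + lie_comm g h.
Proof.
rewrite /lie_comm comp_lfunDl comp_lfunDr -comp_lfunZl -comp_lfunZr.
by rewrite scalerBr opprD addrACA.
Qed.

Lemma lie_commDr a f g h :
  lie_comm h (a *: f + g) = a *: lie_comm h f + lie_comm h g.
Proof.
rewrite /lie_comm comp_lfunDl comp_lfunDr -comp_lfunZl -comp_lfunZr.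
by rewrite scalerBr opprD addrACA.
Qed.

Lemma lie_comm_jacobi f g h :
  lie_comm f (lie_comm g h) + lie_comm g (lie_comm h f)
    + lie_comm h (lie_comm f g) = 0.
Proof.
rewrite /lie_comm !(comp_lfunDl, comp_lfunDr, comp_lfunNl, comp_lfunNr).
rewrite !comp_lfunA !opprB !addrA.
(* Each of the six triple products occurs twice, with opposite signs. *)
rewrite (ACl (1*12*(2*7)*(3*10)*(4*5)*(6*11)*(8*9)))%AC /=.
by rewrite !subrr !addNr !addr0.
Qed.

Variables (X : Type) (gens : X -> 'End(V)).

(** The value in gl(V) of a Lie word, given the images of the generators. *)
Fixpoint lie_eval (s : lie_word K X) : 'End(V) :=
  match s with
  | LGen x => gens x
  | LZero => 0
  | LAdd s t => lie_eval s + lie_eval t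
  | LScale a s => a *: lie_eval s
  | LBrk s t => lie_comm (lie_eval s) (lie_eval t)
  end.

Variable rels : lie_word K X -> Prop.
Hypothesis rels0 : forall s, rels s -> lie_eval s = 0.

Lemma lie_eval_cong s t : lie_cong rels s t -> lie_eval s = lie_eval t.
Proof.
elim=> //= {s t}.
- by move=> s t u _ -> _ ->.
- by move=> s s' t t' _ -> _ ->.
- by move=> a s s' _ ->.
- by move=> s s' t t' _ -> _ ->.
- by move=> *; rewrite addrA.
- by move=> *; rewrite addrC.
- by move=> *; rewrite add0r.
- by move=> *; rewrite scaleN1r addNr.
- by move=> *; rewrite scalerA.
- by move=> *; rewrite scale1r.
- by move=> *; rewrite scalerDr.
- by move=> *; rewrite scalerDl.
- by move=> *; rewrite lie_commDl.
- by move=> *; rewrite lie_commDr.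
- by move=> *; rewrite /lie_comm subrr.
- by move=> *; rewrite lie_comm_jacobi.
Qed.

(** Evaluation descends to the presented Lie algebra; it is computed on the
    canonical representative of a class. *)
Definition presented_rep_fun (x : presented_lie rels) : 'End(V) :=
  lie_eval (repr x).

Lemma presented_rep_funE s :
  presented_rep_fun (\pi_(presented_lie rels) s)%qT = lie_eval s.
Proof. by apply: lie_eval_cong; apply: pres_repr. Qed.

(** The universal property of a presentation: operators satisfying the
    relations extend to a representation. *)
Lemma presented_rep : exists rho : lie_rep (presented_lie rels) V,
  forall x, rho (pres_gen rels x) = gens x.
Proof.
have lin : linear presented_rep_fun.
  move=> a; elim/quotW=> s; elim/quotW=> t.
  by rewrite -clsZ -clsD !presented_rep_funE.
pose L := GRing.isLinear.Build K (presented_lie rels) 'End(V) *:%R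
  presented_rep_fun lin.
pose F : {linear presented_lie rels -> 'End(V)} := HB.pack presented_rep_fun L.
have brkF x y : F (brk x y) = (F x \o F y)%VF - (F y \o F x)%VF.
  elim/quotW: x => s; elim/quotW: y => t.
  have -> : brk (\pi_(presented_lie rels) s)%qT (\pi_(presented_lie rels) t)%qT
          = (\pi_(presented_lie rels) (LBrk s t))%qT by apply: pres_brkE.
  by rewrite /F /= !presented_rep_funE.
by exists (LieRep brkF) => x; apply: presented_rep_funE.
Qed.

End Presentation.

(** * The weight coefficients *)

Section DotProduct.
Variables (R : realType) (n : nat).
Implicit Types u v a b : 'rV[R]_n.

Lemma dotC v a : dot v a = dot a v.
Proof. by apply: eq_bigr => i _; rewrite mulrC. Qed.

Lemma dotDl u v a : dot (u + v) a = dot u a + dot v a.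
Proof. by rewrite -big_split; apply: eq_bigr => i _; rewrite mxE mulrDl. Qed.

Lemma dotZl (k : R) v a : dot (k *: v) a = k * dot v a.
Proof. by rewrite /dot mulr_sumr; apply: eq_bigr => i _; rewrite mxE mulrA. Qed.

Lemma dotNl v a : dot (- v) a = - dot v a.
Proof. by rewrite -scaleN1r dotZl mulN1r. Qed.

Lemma dotDr u v a : dot a (u + v) = dot a u + dot a v.
Proof. by rewrite !(dotC a) dotDl. Qed.

Lemma dotZr (k : R) v a : dot v (k *: a) = k * dot v a.
Proof. by rewrite !(dotC v) dotZl. Qed.

Lemma dotNr v a : dot v (- a) = - dot v a.
Proof. by rewrite !(dotC v) dotNl. Qed.

Lemma dot_eq0 a : (dot a a == 0) = (a == 0).
Proof.
apply/eqP/eqP => [a0|->]; last first.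
  by rewrite /dot big1 // => i _; rewrite mxE mul0r.
apply/rowP => i; rewrite mxE.
have /eqP := @psumr_eq0P _ _ predT (fun i : 'I_n => a 0 i * a 0 i)
  (fun i _ => sqr_ge0 (a 0 i)) a0 i isT.
by rewrite mulf_eq0 orbb => /eqP.
Qed.

Lemma wcoefD u v a : wcoef (u + v) a = wcoef u a + wcoef v a.
Proof. by rewrite /wcoef dotDl mulrDr mulrDl. Qed.

Lemma wcoefN v a : wcoef (- v) a = - wcoef v a.
Proof. by rewrite /wcoef dotNl mulrN mulNr. Qed.

Lemma wcoef_oppr v a : wcoef v (- a) = - wcoef v a.
Proof. by rewrite /wcoef dotNr dotNl dotNr opprK mulrN mulNr. Qed.

Lemma wcoef_self a : a != 0 -> wcoef a a = 2.
Proof. by move=> a0; rewrite /wcoef mulfK // dot_eq0. Qed.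

Lemma wcoef_eq0C a b : a != 0 -> b != 0 -> (wcoef a b == 0) = (wcoef b a == 0).
Proof.
move=> a0 b0; rewrite /wcoef !mulf_eq0 !invr_eq0 !dot_eq0.
by rewrite (negPf a0) (negPf b0) (dotC a b).
Qed.

End DotProduct.

(** * The operators on the basis of V_Psi *)

Section Operators.
Variables (R : realType) (n : nat) (Psi : {fset 'rV[R]_n}).
Implicit Types (v w a b : 'rV[R]_n) (x : VPsi Psi).
Local Notation bv := (bvec Psi).

Lemma bvec_out w : w \notin Psi -> bv w = 0.
Proof.
move=> wP; apply/ffunP => u; rewrite !ffunE; case: eqP => // uw.
by rewrite -uw (valP u) in wP.
Qed.

Lemma bvec_neq0 w : w \in Psi -> bv w != 0.
Proof.
move=> wP; apply/eqP => /ffunP /(_ [` wP]%fset); rewrite !ffunE /= eqxx.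
by move/eqP; rewrite oner_eq0.
Qed.

Lemma VPsi_scaleE (k : R[i]) x (u : Psi) : (k *: x) u = k * x u.
Proof. by rewrite ffunE. Qed.

Lemma bvec_expand x : x = \sum_(u : Psi) (x u : R[i]) *: bv (val u).
Proof.
apply/ffunP => w; rewrite sum_ffunE.
under eq_bigr => u _ do rewrite (VPsi_scaleE (x u) (bv (val u)) w) ffunE.
rewrite (bigD1 w) //= eqxx mulr1.
rewrite [X in _ = _ + X]big1 ?addr0 // => u uw.
by rewrite eq_sym (inj_eq val_inj) (negPf uw) mulr0.
Qed.

Lemma End_VPsi_ext (f g : 'End(VPsi Psi)) :
  (forall v, v \in Psi -> f (bv v) = g (bv v)) -> f = g.
Proof.
move=> fg; apply/lfunP => x; rewrite (bvec_expand x) !linear_sum /=.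
by apply: eq_bigr => u _; rewrite !linearZ /= fg // (valP u).
Qed.

Lemma lin_ext_bvec (g : Psi -> VPsi Psi) (u : Psi) :
  lin_ext g (bv (val u)) = g u.
Proof.
rewrite /lin_ext (bigD1 u) //= ffunE eqxx scale1r big1 ?addr0 // => w wu.
by rewrite ffunE (inj_eq val_inj) (negPf wu) scale0r.
Qed.

(** No case distinction is needed, since bvec vanishes outside Psi. *)
Lemma opE_bvec v a : v \in Psi -> opE Psi a (bv v) = bv (v + a).
Proof.
move=> vP; rewrite lfunE /= (lin_ext_bvec _ [` vP]%fset) /=.
by case: ifPn => // vaP; rewrite bvec_out.
Qed.

Lemma opF_bvec v a : v \in Psi -> opF Psi a (bv v) = bv (v - a).
Proof. exact: opE_bvec. Qed.

Lemma opH_bvec v a : opH Psi a (bv v) = ((wcoef v a)%:C)%C *: bv v.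
Proof.
case: (boolP (v \in Psi)) => vP; last by rewrite !bvec_out // linear0 scaler0.
by rewrite lfunE /= (lin_ext_bvec _ [` vP]%fset).
Qed.

(** The coordinates of E_a x. *)
Lemma opE_coef x a (w : Psi) :
  opE Psi a x w = \sum_(u : Psi) (x u : R[i]) * (val w == val u + a)%:R.
Proof.
rewrite {1}(bvec_expand x) linear_sum sum_ffunE; apply: eq_bigr => u _.
by rewrite linearZ /= opE_bvec ?(valP u) // !ffunE.
Qed.

Lemma opE_coef_shift x a (u w : Psi) :
  val w = val u + a -> opE Psi a x w = x u.
Proof.
move=> wu; rewrite opE_coef (bigD1 u) //= wu eqxx mulr1 big1 ?addr0 // => t tu.
by rewrite (inj_eq (addIr a)) (inj_eq val_inj) eq_sym (negPf tu) mulr0.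
Qed.

Lemma opE_coef_neq0 x a (w : Psi) :
  opE Psi a x w != 0 -> exists2 u : Psi, x u != 0 & val w = val u + a.
Proof.
rewrite opE_coef => nz.
suff /existsP[u /andP[xu /eqP wu]] :
    [exists u : Psi, (x u != 0) && (val w == val u + a)] by exists u.
apply: contraNT nz => /existsPn no; rewrite big1 // => u _.
have := no u; rewrite negb_and negbK => /orP[/eqP->|/negPf->].
  by rewrite mul0r.
by rewrite mulr0.
Qed.

(** The condition of a minuscule system for a single vector of the simple
    system, with the coefficient made explicit. *)
Definition minuscule_for a : Prop := a != 0 /\ forall v, v \in Psi ->
  [/\ wcoef v a = -1 \/ wcoef v a = 0 \/ wcoef v a = 1,
      (v + a \in Psi) = (wcoef v a == -1) &
      (v - a \in Psi) = (wcoef v a == 1)].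

Lemma minuscule_forN a : minuscule_for a -> minuscule_for (- a).
Proof.
case=> a0 H; split=> [|v vP]; first by rewrite oppr_eq0.
have [c cE cF] := H v vP; rewrite wcoef_oppr opprK cE cF.
split; first by case: c => [->|[->|->]]; rewrite ?opprK ?oppr0; tauto.
  by rewrite (inj_eq oppr_inj).
by rewrite eqr_oppLR.
Qed.

Lemma minuscule_systemP (D : set 'rV[R]_n) :
  (forall a, D a -> minuscule_for a) <->
  minuscule_system [set` Psi]%classic D.
Proof.
split=> [H|[D0 H] a Da].
  split=> [/H[]|v a vP /H[a0 /(_ v vP)[c cE cF]]]; first by rewrite eqxx.
  exists (wcoef v a); split => //=; rewrite ?cE ?cF.
  - by rewrite /wcoef divfK ?dot_eq0.
  - by split=> /eqP.
  - by split=> /eqP.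
have a0 : a != 0 by apply/eqP => a0; rewrite a0 in Da.
split=> // v vP; have [c [c3 ce cE cF]] := H v a vP Da.
have -> : wcoef v a = c by rewrite /wcoef ce mulfK ?dot_eq0.
by split => //; apply/idP/eqP; [apply cE|apply cE|apply cF|apply cF].
Qed.

End Operators.

(** * The Kac-Moody relations *)

(** The relations are derived from the action on a spanning family bv indexed
    by Psi and extended by 0, in an arbitrary space V. There is no separate
    family F, as F_a acts on the basis as E_(-a). *)
Section Relations.
Variables (R : realType) (n : nat) (Psi : {fset 'rV[R]_n}) (V : vectType R[i]).
Variables (bv : 'rV[R]_n -> V) (E H : 'rV[R]_n -> 'End(V)).
Hypothesis bv_ext : forall f g : 'End(V),
  (forall v, v \in Psi -> f (bv v) = g (bv v)) -> f = g.
Hypothesis bv_out : forall v, v \notin Psi -> bv v = 0.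
Hypothesis E_bv : forall v a, v \in Psi -> E a (bv v) = bv (v + a).
Hypothesis H_bv : forall v a, H a (bv v) = ((wcoef v a)%:C)%C *: bv v.
Implicit Types (v w a b : 'rV[R]_n).

Lemma lie_commE (f g : 'End(V)) x :
  lie_comm f g x = f (g x) - g (f x).
Proof. by rewrite /lie_comm add_lfunE opp_lfunE !comp_lfunE. Qed.

Lemma lfunZ (f : 'End(V)) k x :
  f (k *: x) = k *: f x.
Proof. exact: linearZ. Qed.

Lemma comm_H_H a b : lie_comm (H a) (H b) = 0.
Proof.
apply: bv_ext => v vP.
rewrite lie_commE !H_bv !lfunZ !H_bv !scalerA.
by rewrite [X in X *: _ - _]mulrC subrr zero_lfunE.
Qed.

Lemma comm_H_E a b : lie_comm (H a) (E b) = ((wcoef b a)%:C)%C *: E b.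
Proof.
apply: bv_ext => v vP.
rewrite lie_commE H_bv lfunZ !E_bv // H_bv -scalerBl.
by rewrite wcoefD raddfD /= addrAC subrr add0r scale_lfunE E_bv.
Qed.

Lemma E_E_bv v a b : minuscule_for Psi a -> v \in Psi ->
  E b (E a (bv v)) = if wcoef v a == -1 then bv (v + a + b) else 0.
Proof.
case=> a0 Ha vP; have [_ cE _] := Ha v vP; rewrite E_bv // -cE.
case: ifPn => vaP; first by rewrite E_bv.
by rewrite bv_out // linear0.
Qed.

Lemma comm_E_EN_self a :
  minuscule_for Psi a -> lie_comm (E a) (E (- a)) = H a.
Proof.
move=> Ma; apply: bv_ext => v vP.
rewrite lie_commE !E_E_bv //; last exact: minuscule_forN.
rewrite H_bv wcoef_oppr eqr_opp addrNK addrK.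
have m1 : (-1 == 1 :> R) = false by apply/negbTE/eqP => ?; lra.
have [_ /(_ v vP)[c _ _]] := Ma; case: c => [->|[->|->]].
- by rewrite m1 eqxx sub0r raddfN /= scaleN1r.
- by rewrite eq_sym oner_eq0 eq_sym oppr_eq0 oner_eq0 subrr raddf0 scale0r.
- by rewrite eqxx eq_sym m1 subr0 scale1r.
Qed.

(** A product of two raising operators which does not kill a basis vector
    determines two of its coefficients. *)
Lemma E_E_neq0 a b v : minuscule_for Psi a -> minuscule_for Psi b ->
  v \in Psi -> E b (E a (bv v)) != 0 ->
  wcoef v a = -1 /\ wcoef v b + wcoef a b = -1.
Proof.
move=> Ma [b0 Mb] vP; rewrite E_E_bv //; case: ifPn => [/eqP va|].
  2: by rewrite eqxx.
have vaP : v + a \in Psi by case: Ma => _ /(_ v vP)[_ -> _]; apply/eqP.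
move=> nz; split=> //; rewrite -wcoefD; apply/eqP.
have [_ <- _] := Mb _ vaP; apply: contra_neqT nz; exact: bv_out.
Qed.

(** Two vectors pairing non-negatively can be added in either order: if one
    order leads from v back into Psi, then wcoef v a = wcoef v b = -1
    and a, b are orthogonal. *)
Lemma comm_E_E_eq0 a b : minuscule_for Psi a -> minuscule_for Psi b ->
  0 <= wcoef a b -> 0 <= wcoef b a -> lie_comm (E a) (E b) = 0.
Proof.
move=> Ma Mb ab ba.
have key c d v : minuscule_for Psi c -> minuscule_for Psi d ->
    0 <= wcoef c d -> v \in Psi ->
    E d (E c (bv v)) != 0 -> E c (E d (bv v)) = E d (E c (bv v)).
  move=> Mc Md cd vP nz; have [vc vd] := E_E_neq0 Mc Md vP nz.
  have [_ /(_ v vP)[vd3 _ _]] := Md.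
  have vd1 : wcoef v d = -1 by lra.
  by rewrite !E_E_bv // vd1 vc eqxx addrAC.
apply: bv_ext => v vP; rewrite lie_commE zero_lfunE; apply/eqP.
rewrite subr_eq0.
have [|/(key b a v Mb Ma ba vP) -> //] := eqVneq (E a (E b (bv v))) 0.
have [-> -> //|/(key a b v Ma Mb ab vP) -> //] := eqVneq (E b (E a (bv v))) 0.
Qed.

(** Adding a raises the coefficient at a from -1 to 1, so a cannot be added
    again. *)
Lemma E_sqr a : minuscule_for Psi a -> (E a \o E a)%VF = 0.
Proof.
move=> Ma; apply: bv_ext => v vP; rewrite comp_lfunE zero_lfunE.
apply: contraTeq isT => /(E_E_neq0 Ma Ma vP)[va].
by have [a0 _] := Ma; rewrite va wcoef_self // => ?; exfalso; lra.
Qed.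

(** After adding a, b and before adding a again the coefficient at a is
    1 + wcoef b a, whereas a nonzero product needs -1. *)
Lemma E_sandwich a b : minuscule_for Psi a -> minuscule_for Psi b ->
  wcoef b a != -2 -> (E a \o E b \o E a)%VF = 0.
Proof.
move=> Ma Mb ba; apply: bv_ext => v vP; rewrite !comp_lfunE zero_lfunE.
rewrite E_bv //; case: (boolP (v + a \in Psi)) => vaP; last first.
  by rewrite bv_out // !linear0.
apply: contraNeq ba => /(E_E_neq0 Mb Ma vaP)[_].
have [a0 /(_ v vP)[_ va _]] := Ma; move: vaP; rewrite va => /eqP va1.
by rewrite wcoefD va1 wcoef_self // => e; apply/eqP; lra.
Qed.

(** The Serre relations, for every non-positive Cartan integer z. As E_a^2 = 0,
    the double commutator is -2 E_a E_b E_a and the triple one vanishes: only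
    z = 0 and z = -1 need a further argument. *)
Lemma serre_E a b (z : int) : minuscule_for Psi a -> minuscule_for Psi b ->
  wcoef b a = z%:~R -> z <= 0 ->
  iter `|1 - z|%N (lie_comm (E a)) (E b) = 0.
Proof.
move=> Ma Mb ba z0.
have sq := E_sqr Ma.
have ad2 : lie_comm (E a) (lie_comm (E a) (E b)) =
      - ((E a \o E b \o E a)%VF *+ 2).
  rewrite /lie_comm !(comp_lfunDl, comp_lfunDr, comp_lfunNl, comp_lfunNr).
  rewrite !comp_lfunA sq comp_lfun0l -(comp_lfunA _ (E a) (E a)) sq comp_lfun0r.
  by rewrite sub0r subr0 mulr2n opprD.
have [[p ->]|[z1|z1]] : (exists p, `|1 - z|%N = p.+3) \/ z = -1 \/ z = 0.
  case: z z0 {ba} => [[|k]|[|k]] // _;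
    [right; right | right; left | left; exists k]; lia.
- rewrite !iterSr ad2.
  have -> : lie_comm (E a) (- ((E a \o E b \o E a)%VF *+ 2)) = 0.
    rewrite /lie_comm mulr2n.
    rewrite !(comp_lfunDl, comp_lfunDr, comp_lfunNl, comp_lfunNr).
    rewrite !comp_lfunA sq !comp_lfun0l -!(comp_lfunA _ (E a) (E a)) sq.
    by rewrite !comp_lfun0r addr0 subrr.
  by elim: p => //= p ->; rewrite /lie_comm comp_lfun0l comp_lfun0r subrr.
- rewrite z1 -[LHS]/(lie_comm (E a) (lie_comm (E a) (E b))) ad2.
  rewrite E_sandwich ?mul0rn ?oppr0 //.
  by rewrite ba z1 mulrN1z; apply/eqP => ?; lra.
- have ba0 : wcoef b a = 0 by rewrite ba z1.
  have ab0 : wcoef a b = 0.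
    by apply/eqP; rewrite wcoef_eq0C ?ba0 //; [case: Ma | case: Mb].
  by rewrite z1 subr0 /= comm_E_E_eq0 // ?ab0 ?ba0.
Qed.

(** A minuscule system whose simple system has generalized Cartan matrix A
    carries a representation of the derived Kac-Moody algebra of A. *)
Theorem minuscule_kac_moody_rep (m : nat) (A : 'M[int]_m)
    (alpha : 'I_m -> 'rV[R]_n) :
  (forall i, minuscule_for Psi (alpha i)) ->
  (forall i j, wcoef (alpha j) (alpha i) = (A i j)%:~R) ->
  (forall i j, i != j -> A i j <= 0) ->
  exists rho : lie_rep (kac_moody R[i] A) V, forall i,
    [/\ rho (km_e R[i] A i) = E (alpha i),
        rho (km_f R[i] A i) = E (- alpha i) &
        rho (km_h R[i] A i) = H (alpha i)].
Proof.
move=> M cA A0.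
have MN i : minuscule_for Psi (- alpha i) by apply: minuscule_forN.
pose gens (x : km_gen 'I_m) := match x with
  | GE i => E (alpha i) | GF i => E (- alpha i) | GH i => H (alpha i) end.
have evad p s t : lie_eval gens (lie_ad p s t) =
    iter p (lie_comm (lie_eval gens s)) (lie_eval gens t).
  by elim: p => //= p ->.
have A0R i j : i != j -> wcoef (alpha j) (alpha i) <= 0.
  by move=> ij; rewrite cA lerz0 A0.
have rels0 s : @km_rel R[i] m A s -> lie_eval gens s = 0.
  case=> {s} [i j|i j|i j|i j|i j ij|i j ij] /=.
  - exact: comm_H_H.
  - by rewrite comm_H_E cA scaleN1r rmorph_int subrr.
  - by rewrite comm_H_E wcoefN cA scaleN1r rmorphN /= rmorph_int subrr.
  - rewrite scaleN1r; have [<-|ij] := eqVneq i j.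
      by rewrite comm_E_EN_self // scale1r subrr.
    rewrite scale0r subr0 comm_E_E_eq0 //.
      by rewrite wcoef_oppr oppr_ge0 A0R // eq_sym.
    by rewrite wcoefN oppr_ge0 A0R.
  - by rewrite evad; apply: serre_E => //; apply: A0.
  - rewrite evad; apply: serre_E => //; last exact: A0.
    by rewrite wcoef_oppr wcoefN opprK.
have [rho rhoE] := presented_rep rels0.
by exists rho => i; split; apply: rhoE.
Qed.

End Relations.

(** * Highest weight vectors and irreducibility *)

Section Maximal.
Variables (R : realType) (n : nat) (Psi : {fset 'rV[R]_n}).
Variables (m : nat) (alpha : 'I_m -> 'rV[R]_n).
Implicit Types (v w : 'rV[R]_n) (x : VPsi Psi).
Local Notation bv := (bvec Psi).

(** top is the only element of Psi to which no alpha i can be added within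
    Psi. *)
Definition sole_maximal (top : 'rV[R]_n) : Prop :=
  top \in Psi /\
  forall v, v \in Psi -> (v = top <-> forall i, v + alpha i \notin Psi).

Variable top : 'rV[R]_n.
Hypothesis topP : sole_maximal top.

(** The operators E act injectively on the basis vectors that they do not
    kill, so the coordinate of a killed vector vanishes at u as soon as some
    u + alpha i is in Psi. *)
Lemma opE_killed x :
  (forall i, opE Psi (alpha i) x = 0) <-> exists c : R[i], x = c *: bv top.
Proof.
have [tP tmax] := topP; split=> [x0|[c ->] i]; last first.
  rewrite lfunZ (opE_bvec (alpha i) tP) bvec_out ?scaler0 //.
  by have [/(_ erefl)] := tmax top tP.
exists (x [` tP]%fset); rewrite {1}(bvec_expand x) (bigD1 [` tP]%fset) //=.
rewrite [X in _ + X]big1 ?addr0 // => u ut.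
have [i uaP] : exists i, val u + alpha i \in Psi.
  apply: contrapT => no; case/negP: ut; apply/eqP/val_inj => /=.
  apply/tmax; first exact: valP.
  by move=> i; apply/negP => uaP; apply: no; exists i.
rewrite -(@opE_coef_shift _ _ _ x (alpha i) u [` uaP]%fset) // x0 ffunE.
exact: scale0r.
Qed.

Variable ht : 'rV[R]_n.
Hypothesis ht_alpha : forall i, 0 < dot (alpha i) ht.

(** The number of elements of Psi higher than v for the linear form defined
    by ht. *)
Definition depth v : nat := #|[pred w : Psi | dot v ht < dot (val w) ht]|.

Lemma depth_alpha v i : v + alpha i \in Psi ->
  (depth (v + alpha i) < depth v)%N.
Proof.
move=> vaP; apply: proper_card; apply/fintype.properP; split.
  apply/fintype.subsetP => w; rewrite !inE; apply: lt_trans.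
  by rewrite dotDl ltrDl ht_alpha.
by exists [` vaP]%fset; rewrite !inE /= ?ltxx // dotDl ltrDl ht_alpha.
Qed.

(** By induction on a bound for the depth of the support of a nonzero x in U:
    either all E kill x, which is then a multiple of bv top, or some E x is
    nonzero and has a support of smaller depth. *)
Lemma invariant_top (U : {vspace VPsi Psi}) : U <> 0%VS ->
  (forall i x, x \in U -> opE Psi (alpha i) x \in U) -> bv top \in U.
Proof.
move=> U0 UE.
have descend N x : x \in U -> x != 0 ->
    (forall u : Psi, x u != 0 -> (depth (val u) < N)%N) -> bv top \in U.
  elim: N x => [|N IH] x xU x0 xN.
    case/eqP: x0; apply/ffunP => u; rewrite ffunE; apply/eqP.
    by apply: contraT => /xN.
  have [kill|/existsNP[i /eqP Ex0]] :=
      pselect (forall i, opE Psi (alpha i) x = 0).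
    have [c xc] := (opE_killed x).1 kill.
    have c0 : c != 0 by apply: contra_neq x0 => c0; rewrite xc c0 scale0r.
    have -> : bv top = c^-1 *: x by rewrite xc scalerA mulVf // scale1r.
    exact: memvZ.
  apply: (IH (opE Psi (alpha i) x)) => // [|w].
    exact: UE.
  case/opE_coef_neq0 => u xu wu.
  have uaP : val u + alpha i \in Psi by rewrite -wu (valP w).
  by rewrite wu; have := depth_alpha uaP; have := xN u xu; lia.
have [x xU x0] : exists2 x, x \in U & x != 0.
  exists (vpick U); first exact: memv_pick.
  by rewrite vpick0; apply/eqP.
apply: (descend #|{: Psi}|.+1 x) => // u _.
by rewrite ltnS max_card.
Qed.

(** From bv top the operators F reach every basis vector. *)
Lemma invariant_full (U : {vspace VPsi Psi}) : U <> 0%VS ->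
  (forall i x, x \in U -> opE Psi (alpha i) x \in U) ->
  (forall i x, x \in U -> opF Psi (alpha i) x \in U) -> U = fullv.
Proof.
move=> U0 UE UF; have topU := invariant_top U0 UE.
have [tP tmax] := topP.
have all_bv N v : v \in Psi -> (depth v < N)%N -> bv v \in U.
  elim: N v => // N IH v vP vN.
  have [/(tmax v vP) -> //|/existsNP[i /negP]] :=
    pselect (forall i, v + alpha i \notin Psi).
  rewrite negbK => vaP.
  rewrite -[v](addrK (alpha i)) -(opF_bvec (alpha i) vaP); apply: (UF i).
  by apply: IH => //; have := depth_alpha vaP; lia.
apply/vspaceP => x; rewrite memvf (bvec_expand x); apply: memv_suml => u _.
by apply/memvZ/(all_bv (depth (val u)).+1); first exact: valP.
Qed.

Variables (A : 'M[int]_m) (rho : lie_rep (kac_moody R[i] A) (VPsi Psi)).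
Hypothesis rhoP : acts_by_operators rho alpha.

Theorem sole_maximal_irreducible : irreducible_rep rho.
Proof.
split=> [full0|U Uinv].
  have := bvec_neq0 topP.1; have := memvf (bv top); rewrite full0 memv0.
  by move=> ->.
have [->|/eqP U0] := eqVneq U 0%VS; [by left|right].
have Uin g x : x \in U -> rho g x \in U.
  by move=> xU; apply: (subvP (Uinv g)); apply: memv_img.
apply: invariant_full => // i x xU; have [rE rF _] := rhoP i.
  by rewrite -rE; apply: Uin.
by rewrite -rF; apply: Uin.
Qed.

Lemma bvec_has_weight v :
  has_weight rho (fun i => ((wcoef v (alpha i))%:C)%C) (bv v).
Proof. by move=> i; have [_ _ ->] := rhoP i; apply: opH_bvec. Qed.

Lemma bvec_weight_vector v (c : R[i]) : v \in Psi -> c <> 0 ->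
  weight_vector rho (c *: bv v).
Proof.
move=> vP /eqP c0; split.
  by apply/eqP; rewrite scaler_eq0 negb_or c0 bvec_neq0.
exists (fun i => ((wcoef v (alpha i))%:C)%C) => i.
by rewrite lfunZ bvec_has_weight scalerA mulrC -scalerA.
Qed.

Theorem highest_weight_vectorP x : highest_weight_vector rho x <->
  exists2 c : R[i], c <> 0 & x = c *: bv top.
Proof.
split=> [[[x0 _] Ex0]|[c c0 ->]].
  have [i|c xc] := (opE_killed x).1; first by have [<-] := rhoP i.
  by exists c => // c0; apply: x0; rewrite xc c0 scale0r.
split; first exact: bvec_weight_vector topP.1 c0.
move=> i; have [-> _ _] := rhoP i.
by apply: (opE_killed _).2; exists c.
Qed.

Theorem sole_maximal_affords (omega : 'I_m -> R[i]) :
  (forall i, ((wcoef top (alpha i))%:C)%C = omega i) -> affords_L rho omega.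
Proof.
move=> wE; split; first exact: sole_maximal_irreducible.
exists (bv top); last by move=> i; rewrite -wE; apply: bvec_has_weight.
by apply/highest_weight_vectorP; exists 1; rewrite ?scale1r //;
  apply/eqP/oner_neq0.
Qed.

End Maximal.

(** Lowest weight vectors, via the opposite simple system: F_a and E_(-a) are
    the same operator by definition. *)
Theorem lowest_weight_vectorP (R : realType) (n m : nat) (Psi : {fset 'rV[R]_n})
    (alpha : 'I_m -> 'rV[R]_n) (bot : 'rV[R]_n) (A : 'M[int]_m)
    (rho : lie_rep (kac_moody R[i] A) (VPsi Psi)) x :
  sole_maximal Psi (fun i => - alpha i) bot -> acts_by_operators rho alpha ->
  lowest_weight_vector rho x <->
  exists2 c : R[i], c <> 0 & x = c *: bvec Psi bot.
Proof.
move=> botP rhoP; split=> [[[x0 _] Fx0]|[c c0 ->]].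
  have [i|c xc] := (opE_killed botP x).1.
    by have [_ rF _] := rhoP i; rewrite -[LHS]/(opF Psi (alpha i) x) -rF.
  by exists c => // c0; apply: x0; rewrite xc c0 scale0r.
split; first exact: bvec_weight_vector rhoP _ _ botP.1 c0.
move=> i; have [_ -> _] := rhoP i.
by apply: (opE_killed botP _).2; exists c.
Qed.

(** An isomorphism maps a vector killed by all E to such a vector, of the same
    weight. *)
Theorem nonisomorphic_of_tops (R : realType) (n m : nat)
    (Psi1 Psi2 : {fset 'rV[R]_n}) (alpha : 'I_m -> 'rV[R]_n)
    (top1 top2 : 'rV[R]_n) (A : 'M[int]_m)
    (rho1 : lie_rep (kac_moody R[i] A) (VPsi Psi1))
    (rho2 : lie_rep (kac_moody R[i] A) (VPsi Psi2)) i :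
  sole_maximal Psi1 alpha top1 -> sole_maximal Psi2 alpha top2 ->
  acts_by_operators rho1 alpha -> acts_by_operators rho2 alpha ->
  wcoef top1 (alpha i) != wcoef top2 (alpha i) -> ~ isomorphic_rep rho1 rho2.
Proof.
move=> top1P top2P rho1P rho2P wne [phi [psi phiK _] phiE].
have b10 : phi (bvec Psi1 top1) != 0.
  apply: contra_neq (bvec_neq0 top1P.1) => p0.
  by rewrite -(phiK (bvec _ _)) p0 -(phiK 0) linear0.
have [j|c pc] := (opE_killed top2P (phi (bvec Psi1 top1))).1.
  have [<- _ _] := rho2P j; rewrite -phiE; have [-> _ _] := rho1P j.
  rewrite (opE_killed top1P _).2 ?linear0 //; by exists 1; rewrite scale1r.
have := phiE (km_h R[i] A i) (bvec Psi1 top1).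
rewrite (bvec_has_weight rho1P) pc (lfunZ (rho2 _)) (bvec_has_weight rho2P).
have -> k x : phi (k *: x) = k *: phi x by exact: linearZ.
rewrite scalerA [c * _]mulrC -scalerA -pc => /eqP.
rewrite -subr_eq0 -scalerBl scaler_eq0 (negPf b10) orbF subr_eq0.
by move=> /eqP /complexI we; rewrite we eqxx in wne.
Qed.

(** * The half cubes are minuscule *)

Section SignedPairs.
Variables (R : realType) (n : nat).
Implicit Types (v : 'rV[R]_n) (e a b : bool).
Local Notation eps := (eps R n).

Lemma dot_eps v (p : 'I_n) : dot v (eps p) = v 0 p.
Proof.
rewrite /dot (bigD1 p) //= mxE eqxx mulr1 big1 ?addr0 // => i ip.
by rewrite mxE (inj_eq val_inj) (negPf ip) mulr0.
Qed.

Lemma dot_eps_eps k l : (k < n)%N -> dot (eps k) (eps l) = (k == l)%:R :> R.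
Proof. by move=> kn; rewrite dotC (dot_eps _ (Ordinal kn)) mxE. Qed.

(** For distinct p and q, the vector with two nonzero entries of absolute value
    4, at positions p and q, negative when the corresponding boolean is true.
    Every vector of DeltaD is of this form. *)
Definition signed_pair a b (p q : nat) : 'rV[R]_n :=
  4 *: ((-1) ^+ a *: eps p + (-1) ^+ b *: eps q).

Lemma signed_pairN a b p q :
  - signed_pair a b p q = signed_pair (~~ a) (~~ b) p q.
Proof.
by rewrite /signed_pair -scalerN opprD -!scaleNr !signrN.
Qed.

Lemma dot_signed_pair v a b (p q : 'I_n) :
  dot v (signed_pair a b p q) = 4 * ((-1) ^+ a * v 0 p + (-1) ^+ b * v 0 q).
Proof. by rewrite dotZr dotDr !dotZr !dot_eps. Qed.

Lemma signed_pairE a b (p q : nat) (i : 'I_n) : signed_pair a b p q 0 i =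
  4 * ((-1) ^+ a * (val i == p)%:R + (-1) ^+ b * (val i == q)%:R).
Proof. by rewrite !mxE. Qed.

Lemma dot_signed_pair_self a b (p q : 'I_n) : p != q ->
  dot (signed_pair a b p q) (signed_pair a b p q) = 32.
Proof.
move=> pq; rewrite dot_signed_pair !signed_pairE !eqxx (inj_eq val_inj).
rewrite (inj_eq val_inj) [q == p]eq_sym (negPf pq).
by case: a; case: b; rewrite /= ?expr1 ?expr0 ?mulr1n ?mulr0n; ring.
Qed.

Lemma wcoef_signed_pair v a b (p q : 'I_n) : p != q ->
  wcoef v (signed_pair a b p q) =
    ((-1) ^+ a * v 0 p + (-1) ^+ b * v 0 q) / 4.
Proof.
by move=> pq; rewrite /wcoef dot_signed_pair_self // dot_signed_pair; field.
Qed.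

(** The vectors of the cube whose number of negative entries has parity e. *)
Definition half_cube e : {fset 'rV[R]_n} :=
  [fset v in Psi_cube R n | odd (num_neg v) == e]%fset.

Lemma half_cubeE e v :
  (v \in half_cube e) = (v \in Psi_cube R n) && (odd (num_neg v) == e).
Proof. by rewrite !inE. Qed.

Lemma PsiD_plusE : PsiD_plus R n = half_cube false.
Proof. by apply/fsetP => v; rewrite half_cubeE !inE eqbF_neg. Qed.

Lemma PsiD_minusE : PsiD_minus R n = half_cube true.
Proof. by apply/fsetP => v; rewrite half_cubeE !inE eqb_id. Qed.

Lemma two_eqN2 : (2 == -2 :> R) = false.
Proof. by apply/negbTE/eqP => ?; lra. Qed.

Lemma odd_num_neg v : odd (num_neg v) = \big[addb/false]_(i < n) (v 0 i == -2).
Proof.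
rewrite /num_neg -sum1_card big_mkcond /= (big_morph odd oddD (erefl (odd 0))).
by apply: eq_bigr => i _; rewrite inE; case: (v 0 i == -2).
Qed.

Lemma cube_oppr v : (- v \in Psi_cube R n) = (v \in Psi_cube R n).
Proof.
suff H w : w \in Psi_cube R n -> - w \in Psi_cube R n.
  by apply/idP/idP => /H //; rewrite opprK.
move=> /Psi_cubeP wP; apply/Psi_cubeP => i; rewrite mxE.
by case: (wP i) => ->; rewrite ?opprK; [right|left].
Qed.

Lemma half_cube_oppr e v :
  (- v \in half_cube e) = (v \in half_cube (odd n (+) e)).
Proof.
rewrite !half_cubeE cube_oppr; case: (boolP (v \in _)) => //= /Psi_cubeP vP.
have -> : odd (num_neg (- v)) = odd n (+) odd (num_neg v).
  rewrite !odd_num_neg -[X in odd X]card_ord -sum1_card /=.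
  rewrite (big_morph odd oddD (erefl (odd 0))) -big_split /=.
  apply: eq_bigr => i _; rewrite mxE.
  have n2 := two_eqN2.
  by case: (vP i) => ->; rewrite ?opprK eqxx n2.
by case: (odd n); case: (odd _); case: e.
Qed.

Lemma signed_pair_add_cube v a b (p q : 'I_n) : p != q -> v \in Psi_cube R n ->
  (v + signed_pair a b p q \in Psi_cube R n) =
  (wcoef v (signed_pair a b p q) == -1).
Proof.
move=> pq /Psi_cubeP vP; rewrite wcoef_signed_pair //.
have qp : (val q == val p) = false.
  by rewrite (inj_eq val_inj) eq_sym (negPf pq).
apply/idP/eqP => [/Psi_cubeP H|c].
  move: (H p) (H q) (vP p) (vP q) => {H}.
  rewrite !mxE !eqxx [val p == _]eq_sym qp.
  by case: a; case: b; rewrite /= ?expr1 ?expr0 ?mulr1n ?mulr0n; lra.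
apply/Psi_cubeP => i; move: c; rewrite !mxE.
have [->|ip] := eqVneq i p.
  rewrite eqxx [val p == _]eq_sym qp; have := vP p; have := vP q.
  by case: a; case: b; rewrite /= ?expr1 ?expr0 ?mulr1n ?mulr0n; lra.
rewrite (inj_eq val_inj) (negPf ip).
have [->|iq] := eqVneq i q.
  rewrite eqxx; have := vP p; have := vP q.
  by case: a; case: b; rewrite /= ?expr1 ?expr0 ?mulr1n ?mulr0n; lra.
rewrite (inj_eq val_inj) (negPf iq) => _; have := vP i.
by case: a; case: b; rewrite /= ?expr1 ?expr0 ?mulr1n ?mulr0n; lra.
Qed.

(** Adding a root within the cube changes the sign of exactly two entries. *)
Lemma signed_pair_parity v a b (p q : 'I_n) : p != q ->
  v \in Psi_cube R n -> v + signed_pair a b p q \in Psi_cube R n ->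
  odd (num_neg (v + signed_pair a b p q)) = odd (num_neg v).
Proof.
move=> pq /Psi_cubeP vP /Psi_cubeP H.
have qp : (val q == val p) = false.
  by rewrite (inj_eq val_inj) eq_sym (negPf pq).
rewrite !odd_num_neg (bigD1 p) //= (bigD1 q) 1?eq_sym //=.
rewrite [RHS](bigD1 p) //= [in RHS](bigD1 q) 1?eq_sym //= !addbA.
congr (_ (+) _); last first.
  apply: eq_bigr => i /andP[ip iq]; rewrite !mxE !(inj_eq val_inj).
  by rewrite (negPf ip) (negPf iq) !mulr0 !addr0 mulr0 addr0.
have n2 := two_eqN2.
move: (H p) (H q) (vP p) (vP q) => {H}.
rewrite !mxE !eqxx [val p == _]eq_sym qp.
have flip x y : x = 2 \/ x = -2 -> x + y = 2 \/ x + y = -2 -> y != 0 ->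
    (x + y == -2) = ~~ (x == -2 :> R).
  move=> [->|->] xy y0; rewrite ?n2 ?eqxx;
    case: xy => xy; rewrite xy ?n2 ?eqxx //.
    by case/eqP: y0; lra.
  by case/eqP: y0; lra.
move=> Hp Hq vp vq; rewrite !flip // ?addbN ?addNb ?negbK //.
  by apply/eqP; case: a {Hp Hq}; case: b;
    rewrite /= ?expr1 ?expr0 ?mulr1n ?mulr0n; lra.
by apply/eqP; case: a {Hp Hq}; case: b;
    rewrite /= ?expr1 ?expr0 ?mulr1n ?mulr0n; lra.
Qed.

Lemma signed_pair_minuscule e a b (p q : 'I_n) : p != q ->
  minuscule_for (half_cube e) (signed_pair a b p q).
Proof.
move=> pq; split=> [|v].
  rewrite -dot_eq0 dot_signed_pair_self //; apply/eqP => ?; lra.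
have add a' b' : v \in half_cube e ->
    (v + signed_pair a' b' p q \in half_cube e) =
    (wcoef v (signed_pair a' b' p q) == -1).
  rewrite !half_cubeE => /andP[vP vE]; rewrite -signed_pair_add_cube //.
  case: (boolP (_ \in _)) => //= vaP; by rewrite signed_pair_parity.
move=> vP; rewrite signed_pairN !add // -signed_pairN wcoef_oppr eqr_opp.
split=> //; rewrite wcoef_signed_pair //.
move: vP; rewrite half_cubeE => /andP[/Psi_cubeP vP _].
have := vP p; have := vP q.
by case: a; case: b; rewrite /= ?expr1 ?expr0 ?mulr1n ?mulr0n; lra.
Qed.

End SignedPairs.

(** * Dimensions *)

Section Dimension.
Variables (R : realType) (n : nat).
Hypothesis n_gt0 : (0 < n)%N.

Lemma card_Psi_cube : #|` Psi_cube R n| = (2 ^ n)%N.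
Proof.
rewrite /Psi_cube card_fseq undup_id.
  by rewrite size_map -cardE card_ffun card_bool card_ord.
rewrite map_inj_uniq ?enum_uniq // => s t /rowP st; apply/ffunP => i.
have := st i; rewrite !mxE; case: (s i); case: (t i) => // ?; exfalso; lra.
Qed.

(** Changing the sign of the entry at position 0 exchanges the half cubes. *)
Definition flip0 (v : 'rV[R]_n) : 'rV[R]_n :=
  \row_i (if val i == 0%N then - v 0 i else v 0 i).

Lemma flip0K : involutive flip0.
Proof.
by move=> v; apply/rowP => i; rewrite !mxE; case: (_ == _); rewrite ?opprK.
Qed.

Lemma flip0_half e v : v \in half_cube R n e ->
  flip0 v \in half_cube R n (~~ e).
Proof.
rewrite !half_cubeE => /andP[/Psi_cubeP vP /eqP vE]; apply/andP; split.
  apply/Psi_cubeP => i; rewrite mxE; case: ifP => // _.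
  by case: (vP i) => ->; rewrite ?opprK; [right|left].
rewrite -vE !odd_num_neg (bigD1 (Ordinal n_gt0)) //=.
rewrite [X in _ == ~~ X](bigD1 (Ordinal n_gt0)) //= -addNb mxE /=.
have n2 := two_eqN2 R.
apply/eqP; congr (_ (+) _).
  by case: (vP (Ordinal n_gt0)) => ->; rewrite ?opprK eqxx n2.
by apply: eq_bigr => i; rewrite mxE -(inj_eq val_inj) /= => /negPf ->.
Qed.

Lemma card_half_cube e : #|` half_cube R n e| = (2 ^ (n - 1))%N.
Proof.
have le e1 : (#|` half_cube R n e1| <= #|` half_cube R n (~~ e1)|)%N.
  have -> : #|` half_cube R n e1| =
      #|` [fset flip0 v | v in half_cube R n e1]%fset|.
    by rewrite [RHS]card_imfset //; exact: (inv_inj flip0K).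
  apply: fsubset_leq_card; apply/fsubsetP => w /imfsetP[v /= vP ->].
  exact: flip0_half.
have eqc : #|` half_cube R n (~~ e)| = #|` half_cube R n e|.
  by apply/eqP; rewrite eqn_leq le andbT -{2}[e]negbK le.
have tot : (#|` half_cube R n e| + #|` half_cube R n (~~ e)| = 2 ^ n)%N.
  rewrite -card_Psi_cube -cardfsUI.
  have -> : (half_cube R n e `&` half_cube R n (~~ e) = fset0)%fset.
    apply/fsetP => v; rewrite in_fsetI !half_cubeE in_fset0.
    by case: (v \in _) => //=; case: odd; case: (e).
  rewrite cardfs0 addn0; congr #|` _|; apply/fsetP => v.
  rewrite in_fsetU !half_cubeE.
  by case: (v \in _) => //=; case: odd; case: (e).
have pow : (2 ^ n = 2 * 2 ^ (n - 1))%N by rewrite -expnS; congr expn; lia.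
by move: tot; rewrite eqc pow; lia.
Qed.

Lemma dim_VPsi (Psi : {fset 'rV[R]_n}) : \dim {: VPsi Psi} = #|` Psi|.
Proof.
by rewrite dimvf cardfE; apply: muln1.
Qed.

End Dimension.

(** * The simple systems of types D_n^(1) and D_n *)

(** Decides each comparison of natural numbers in the goal, splitting on an
    equality or inequality that the hypotheses leave open. *)
Ltac decide_nat := repeat match goal with
  | |- context [@eq_op _ ?a ?b] =>
      first [ have -> : (a == b) = false by lia
            | have -> : (a == b) = true by lia
            | case: (eqVneq a b) => ? ]
  | |- context [leq ?a ?b] =>
      first [ have -> : leq a b = false by lia
            | have -> : leq a b = true by lia
            | case: (leqP a b) => ? ]
  end.

Section TypeD.
Variables (R : realType) (n : nat).
Hypothesis n_ge4 : (4 <= n)%N.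
Implicit Types (v : 'rV[R]_n).

Lemma alphaD_signed_pair k : (k <= n)%N -> exists a b, exists p q : 'I_n,
  p != q /\ alphaD R n k = signed_pair R n a b p q.
Proof.
move=> kn; rewrite /alphaD /signed_pair.
have [k0|k0] := eqVneq k 0%N.
  have h0 : (0 < n)%N by lia.
  have h1 : (1 < n)%N by lia.
  exists true, true, (Ordinal h0), (Ordinal h1); split=> //=.
  by rewrite !expr1 !scaleN1r -opprD scalerN scaleNr.
case: ifP => kn'.
  have hk : (k - 1 < n)%N by lia.
  exists false, true, (Ordinal hk), (Ordinal kn'); split.
    by rewrite -(inj_eq val_inj) /=; lia.
  by rewrite /= expr1 expr0 scale1r scaleN1r.
have h2 : (n - 2 < n)%N by lia.
have h1 : (n - 1 < n)%N by lia.
exists false, false, (Ordinal h2), (Ordinal h1); split.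
  by rewrite -(inj_eq val_inj) /=; lia.
by rewrite /= expr0 !scale1r.
Qed.

Lemma alphaD_minuscule e k : (k <= n)%N ->
  minuscule_for (half_cube R n e) (alphaD R n k).
Proof.
move=> /alphaD_signed_pair[a [b [p [q [pq ->]]]]].
by apply: signed_pair_minuscule.
Qed.

Lemma dot_alphaD i j : (i <= n)%N -> (j <= n)%N ->
  dot (alphaD R n i) (alphaD R n j) =
  16 * (simply_laced_entry (D1_edge n) i j)%:~R.
Proof.
move=> ni nj.
have h0 : (0 < n)%N by lia.
have h1 : (1 < n)%N by lia.
have hn1 : (n - 1 < n)%N by lia.
have hn2 : (n - 2 < n)%N by lia.
have hi : (i - 1 < n)%N by lia.
rewrite /alphaD /simply_laced_entry /D1_edge /D_edge.
case: (eqVneq i 0%N) => i0; case: (eqVneq j 0%N) => j0;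
  case: (ltnP i n) => hin; case: (ltnP j n) => hjn;
  rewrite !(dotZl, dotZr, dotDl, dotDr, dotNl, dotNr) !dot_eps_eps //;
  decide_nat; rewrite /= ?mulr1n ?mulr0n ?mulr1z ?mulrN1z ?mulr0z; ring.
Qed.

Lemma wcoef_alphaD i j : (i <= n)%N -> (j <= n)%N ->
  wcoef (alphaD R n j) (alphaD R n i) =
  (simply_laced_entry (D1_edge n) i j)%:~R.
Proof.
move=> ni nj; rewrite /wcoef dotC !dot_alphaD //.
by rewrite [in X in _ / X]/simply_laced_entry eqxx; field.
Qed.

Lemma D1_edgeS i j : D1_edge n i.+1 j.+1 = D_edge n i.+1 j.+1.
Proof. by rewrite /D1_edge andFb orbF. Qed.

Lemma wcoef_node_D1 (i j : 'I_n.+1) :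
  wcoef (node_D1 R n j) (node_D1 R n i) = (cartan_D1 n i j)%:~R.
Proof. by rewrite wcoef_alphaD ?mxE // -ltnS. Qed.

Lemma wcoef_node_D (i j : 'I_n) :
  wcoef (node_D R n j) (node_D R n i) = (cartan_D n i j)%:~R.
Proof.
by rewrite wcoef_alphaD // mxE /simply_laced_entry !D1_edgeS.
Qed.

Lemma simply_laced_le0 (e : rel nat) i j : i != j ->
  simply_laced_entry e i j <= 0.
Proof. by rewrite /simply_laced_entry => /negPf ->; case: ifP. Qed.

Lemma alphaD_inj i j : (i <= n)%N -> (j <= n)%N ->
  alphaD R n i = alphaD R n j -> i = j.
Proof.
move=> ni nj aij; apply/eqP; apply: contraT => ij.
(* Off the diagonal the Cartan matrix never has the diagonal value 2. *)
have := wcoef_alphaD ni nj; rewrite -aij wcoef_alphaD // => /eqP.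
rewrite eqr_int {1}/simply_laced_entry eqxx => /eqP e2.
by have := simply_laced_le0 (D1_edge n) ij; rewrite -e2.
Qed.

Lemma simple_system_D1 :
  simple_system_labelled (DeltaD R n) (node_D1 R n) (cartan_D1 n).
Proof.
split; last exact: wcoef_node_D1.
  move=> i j /alphaD_inj ij; apply: val_inj; apply: ij; rewrite -ltnS.
    exact: ltn_ord.
  exact: ltn_ord.
apply/seteqP; split=> [_ [k /= kn <-]|_ [i _ <-]].
  by exists (inord k) => //; rewrite /node_D1 inordK.
by exists (val i) => //=; rewrite -ltnS.
Qed.

Lemma DeltaD_finP a :
  DeltaD_fin R n a <-> exists i : 'I_n, a = node_D R n i.
Proof.
split=> [[[k /= kn <-] k0]|[i ->]].
  case: k kn k0 => [|k] kn k0; first by case: k0.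
  by exists (Ordinal kn).
split; first by exists i.+1 => //=.
by move=> /= /alphaD_inj; rewrite ltn_ord leq0n => /(_ isT isT).
Qed.

Lemma simple_system_D :
  simple_system_labelled (DeltaD_fin R n) (node_D R n) (cartan_D n).
Proof.
split; last exact: wcoef_node_D.
  by move=> i j /alphaD_inj ij; apply: val_inj; apply: succn_inj; apply: ij.
apply/seteqP; split=> [a /DeltaD_finP[i ->]|_ [i _ <-]]; first by exists i.
by apply/DeltaD_finP; exists i.
Qed.

Lemma minuscule_system_D e :
  minuscule_system [set` half_cube R n e]%classic (DeltaD_fin R n).
Proof.
apply/minuscule_systemP => a /DeltaD_finP[i ->].
exact: alphaD_minuscule (ltn_ord i).
Qed.

(** * The spin modules *)

Lemma operators_rep (Psi : {fset 'rV[R]_n}) m (A : 'M[int]_m)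
    (alpha : 'I_m -> 'rV[R]_n) :
  (forall i, minuscule_for Psi (alpha i)) ->
  (forall i j, wcoef (alpha j) (alpha i) = (A i j)%:~R) ->
  (forall i j, i != j -> A i j <= 0) ->
  exists rho : lie_rep (kac_moody R[i] A) (VPsi Psi),
    acts_by_operators rho alpha.
Proof.
move=> M cA A0.
exact: (minuscule_kac_moody_rep (@End_VPsi_ext _ _ Psi) (@bvec_out _ _ Psi)
  (@opE_bvec _ _ Psi) (@opH_bvec _ _ Psi) M cA A0).
Qed.

Lemma half_cube_rep_D1 e :
  exists rho : lie_rep (kac_moody R[i] (cartan_D1 n)) (VPsi (half_cube R n e)),
    acts_by_operators rho (node_D1 R n).
Proof.
apply: operators_rep => [i|i j|i j ij].
- by apply: alphaD_minuscule; rewrite // -ltnS.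
- exact: wcoef_node_D1.
- by rewrite mxE; apply: simply_laced_le0.
Qed.

Lemma half_cube_rep_D e :
  exists rho : lie_rep (kac_moody R[i] (cartan_D n)) (VPsi (half_cube R n e)),
    acts_by_operators rho (node_D R n).
Proof.
apply: operators_rep => [i|i j|i j ij].
- exact: alphaD_minuscule.
- exact: wcoef_node_D.
- by rewrite mxE; apply: simply_laced_le0; rewrite eqSS.
Qed.

(** The highest weight of the half cube of parity e. *)
Definition half_cube_top e : 'rV[R]_n :=
  2 *: jvec R n - (if e then 4 else 0) *: eps R n (n - 1).

Lemma jvecE (i : 'I_n) : jvec R n 0 i = 1.
Proof.
rewrite /jvec summxE (bigD1 i) //= mxE eqxx big1 ?addr0 // => k ki.
by rewrite mxE (inj_eq val_inj) eq_sym (negPf ki).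
Qed.

Lemma half_cube_topE e (i : 'I_n) : half_cube_top e 0 i =
  if e && (val i == n - 1)%N then -2 else 2.
Proof.
rewrite !mxE jvecE; case: e; case: (_ == _) => /=; lra.
Qed.

Lemma half_cube_top_in e : half_cube_top e \in half_cube R n e.
Proof.
have n2 := two_eqN2 R.
have hl : (n - 1 < n)%N by lia.
rewrite half_cubeE; apply/andP; split.
  by apply/Psi_cubeP => i; rewrite half_cube_topE; case: ifP; [right|left].
rewrite odd_num_neg (bigD1 (Ordinal hl)) //= half_cube_topE eqxx andbT.
rewrite big1 => [|i]; first by case: e; rewrite ?eqxx ?n2.
rewrite -(inj_eq val_inj) /= => /negPf il.
by rewrite half_cube_topE il andbF n2.
Qed.

Lemma wcoef_node_D_inner v (i : 'I_n) (h : (i.+1 < n)%N) :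
  wcoef v (node_D R n i) = (v 0 i - v 0 (Ordinal h)) / 4.
Proof.
have -> : node_D R n i = signed_pair R n false true i (Ordinal h).
  rewrite /node_D /alphaD /= h /signed_pair /= expr0 expr1 scale1r scaleN1r.
  by rewrite subn1.
rewrite wcoef_signed_pair; first by rewrite /= expr0 expr1 mul1r mulN1r.
by rewrite -(inj_eq val_inj) /= neq_ltn ltnSn.
Qed.

Lemma wcoef_node_D_last v (i p q : 'I_n) :
  i = (n - 1)%N :> nat -> p = (n - 2)%N :> nat -> q = (n - 1)%N :> nat ->
  wcoef v (node_D R n i) = (v 0 p + v 0 q) / 4.
Proof.
move=> iE pE qE.
have -> : node_D R n i = signed_pair R n false false p q.
  rewrite /node_D /alphaD /= pE qE; case: ifP => [|_]; first by rewrite iE; lia.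
  by rewrite /signed_pair /= expr0 !scale1r.
rewrite wcoef_signed_pair; first by rewrite /= expr0 !mul1r.
by rewrite -(inj_eq val_inj) /= pE qE; lia.
Qed.

(** A dominant vector of a half cube is its highest weight: a negative entry
    before the last position would propagate to all later positions, and then
    the last two entries would contradict the condition at alpha'_n. *)
Lemma dominant_half_cube e v : v \in half_cube R n e ->
  (forall i, wcoef v (node_D R n i) != -1) -> v = half_cube_top e.
Proof.
move=> vP dom.
have cube : forall i, v 0 i = 2 \/ v 0 i = -2.
  by move: vP; rewrite half_cubeE => /andP[/Psi_cubeP].
have next (i k : 'I_n) : k = i.+1 :> nat -> v 0 i = -2 -> v 0 k = -2.
  move=> ki vi; have [vk|//] := cube k.
  have h : (i.+1 < n)%N by rewrite -ki; apply: ltn_ord.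
  have := dom i; rewrite (wcoef_node_D_inner v h).
  have -> : Ordinal h = k by apply: val_inj.
  by rewrite vi vk => /eqP; lra.
have h2 : (n - 2 < n)%N by lia.
have h1 : (n - 1 < n)%N by lia.
have early (i : 'I_n) : (i < n - 1)%N -> v 0 i = 2.
  move=> il; have [//|vi] := cube i.
  have prop d (k : 'I_n) : k = (i + d)%N :> nat -> v 0 k = -2.
    elim: d k => [|d IH] k kE.
      by rewrite (_ : k = i) //; apply: val_inj; rewrite /= kE addn0.
    have h : (i + d < n)%N by have := ltn_ord k; lia.
    by apply: (next (Ordinal h)); rewrite ?kE ?addnS //; apply: IH.
  have := dom (Ordinal h1).
  rewrite (@wcoef_node_D_last v (Ordinal h1) (Ordinal h2) (Ordinal h1)) //.
  rewrite (prop (n - 2 - i)%N (Ordinal h2)) /=; last by lia.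
  rewrite (prop (n - 1 - i)%N (Ordinal h1)) /=; last by lia.
  by move=> /eqP; lra.
have := vP; rewrite half_cubeE => /andP[_].
have n2 := two_eqN2 R.
rewrite odd_num_neg (bigD1 (Ordinal h1)) //= big1 => [|i]; last first.
  rewrite -(inj_eq val_inj) /= => il; rewrite early ?n2 //.
  by have := ltn_ord i; lia.
rewrite addbF => /eqP last; apply/rowP => i; rewrite half_cube_topE.
case: (ltnP i (n - 1)) => il.
  by rewrite early // (ltn_eqF il) andbF.
have -> : i = Ordinal h1 by apply: val_inj => /=; have := ltn_ord i; lia.
rewrite /= eqxx andbT -last.
by have [->|->] := cube (Ordinal h1); rewrite ?eqxx ?n2.
Qed.

Lemma wcoef_half_cube_top e (i : 'I_n) :
  wcoef (half_cube_top e) (node_D R n i) =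
  fund_weight R (if e then n - 1 else n)%N i.
Proof.
rewrite /fund_weight.
have h2 : (n - 2 < n)%N by lia.
have h1 : (n - 1 < n)%N by lia.
case: (ltnP i.+1 n) => h.
  rewrite (wcoef_node_D_inner _ h) !half_cube_topE /=.
  by case: e; decide_nat => /=; lra.
have iE : i = (n - 1)%N :> nat by have := ltn_ord i; lia.
rewrite (@wcoef_node_D_last _ i (Ordinal h2) (Ordinal h1)) //.
rewrite !half_cube_topE /=.
by case: e; decide_nat => /=; lra.
Qed.

Lemma half_cube_sole_maximal e :
  sole_maximal (half_cube R n e) (node_D R n) (half_cube_top e).
Proof.
split=> [|v vP]; first exact: half_cube_top_in.
have add i w : w \in half_cube R n e ->
    (w + node_D R n i \in half_cube R n e) = (wcoef w (node_D R n i) == -1).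
  by have [_ H] := alphaD_minuscule e (ltn_ord i); move=> /H[].
split=> [-> i|no].
  rewrite add ?half_cube_top_in // wcoef_half_cube_top.
  by rewrite /fund_weight; apply/negP => /eqP; case: (_ == _) => /= ?; lra.
by apply: dominant_half_cube => // i; rewrite -add // no.
Qed.

(** The lowest weight of the half cube of parity e. Negation exchanges the two
    half cubes when n is odd and preserves each of them when n is even. *)
Definition half_cube_bottom e : 'rV[R]_n := - half_cube_top (odd n (+) e).

Lemma half_cube_sole_minimal e :
  sole_maximal (half_cube R n e) (fun i => - node_D R n i) (half_cube_bottom e).
Proof.
have [tP tmax] := half_cube_sole_maximal (odd n (+) e).
have opp v : (v \in half_cube R n e) = (- v \in half_cube R n (odd n (+) e)).
  by rewrite half_cube_oppr addbA addbb.
split=> [|v]; first by rewrite opp opprK.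
rewrite opp => vP; rewrite /half_cube_bottom.
split=> [vt i|no].
  rewrite opp opprD opprK; move: i; apply/tmax => //.
  by rewrite vt opprK.
apply: oppr_inj; rewrite opprK; apply/tmax => // i.
by rewrite -[node_D R n i]opprK -opprD -opp.
Qed.

(** The vector having dot product 4 with each simple root of D_n. *)
Definition half_cube_height : 'rV[R]_n := \row_i (n - 1 - i)%:R.

Lemma half_cube_height_gt0 (i : 'I_n) :
  0 < dot (node_D R n i) half_cube_height.
Proof.
have dot_height k : (k < n)%N ->
    dot (eps R n k) half_cube_height = (n - 1 - k)%:R.
  by move=> kn; rewrite dotC (dot_eps _ (Ordinal kn)) mxE.
rewrite /node_D /alphaD /= subn1 /=; case: ifP => h.
  rewrite dotZl dotDl dotNl !dot_height ?(ltnW h) // mulr_gt0 // subr_gt0.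
  by rewrite ltr_nat; lia.
rewrite dotZl dotDl !dot_height; try lia.
by rewrite mulr_gt0 // -natrD ltr0n; lia.
Qed.

End TypeD.

Theorem proposition5p4 (R : realType) (n : nat) (hn : (4 <= n)%N) :
  [/\ simple_system_labelled (DeltaD R n) (node_D1 R n) (cartan_D1 n),
      \dim {: VPsi (PsiD_plus R n)} = (2 ^ (n - 1))%N,
      \dim {: VPsi (PsiD_minus R n)} = (2 ^ (n - 1))%N,
      exists rho : lie_rep (kac_moody R[i] (cartan_D1 n)) (VPsi (PsiD_plus R n)),
        acts_by_operators rho (node_D1 R n) &
      exists rho : lie_rep (kac_moody R[i] (cartan_D1 n)) (VPsi (PsiD_minus R n)),
        acts_by_operators rho (node_D1 R n)] /\
  [/\ minuscule_system [set` PsiD_plus R n]%classic (DeltaD_fin R n),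
      minuscule_system [set` PsiD_minus R n]%classic (DeltaD_fin R n),
      simple_system_labelled (DeltaD_fin R n) (node_D R n) (cartan_D n) &
      exists (rhop : lie_rep (kac_moody R[i] (cartan_D n)) (VPsi (PsiD_plus R n)))
             (rhom : lie_rep (kac_moody R[i] (cartan_D n)) (VPsi (PsiD_minus R n))),
        [/\ acts_by_operators rhop (node_D R n) /\
            acts_by_operators rhom (node_D R n),
            ~ isomorphic_rep rhop rhom,
            irreducible_rep rhop /\ irreducible_rep rhom,
            (affords_L rhop (@fund_weight _ n n) /\
             affords_L rhom (@fund_weight _ n (n - 1))) \/
            (affords_L rhop (@fund_weight _ n (n - 1)) /\
             affords_L rhom (@fund_weight _ n n)) &
            let bp := bvec (PsiD_plus R n) in
            let bm := bvec (PsiD_minus R n) in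
            let j := jvec R n in
            let e := eps R n (n - 1) in
            [/\ forall x, highest_weight_vector rhop x <->
                  exists2 c : R[i], c <> 0 & x = c *: bp (2 *: j),
                forall x, highest_weight_vector rhom x <->
                  exists2 c : R[i], c <> 0 & x = c *: bm (2 *: j - 4 *: e),
                forall x, lowest_weight_vector rhop x <->
                  exists2 c : R[i], c <> 0 &
                    x = c *: (if odd n then bp (- 2 *: j + 4 *: e)
                              else bp (- 2 *: j)) &
                forall x, lowest_weight_vector rhom x <->
                  exists2 c : R[i], c <> 0 &
                    x = c *: (if odd n then bm (- 2 *: j)
                              else bm (- 2 *: j + 4 *: e))]]].
Proof.
have n_gt0 : (0 < n)%N by apply: leq_trans hn.
rewrite !PsiD_plusE !PsiD_minusE; split.
  split.
  - exact: simple_system_D1.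
  - by rewrite dim_VPsi card_half_cube.
  - by rewrite dim_VPsi card_half_cube.
  - exact: half_cube_rep_D1.
  - exact: half_cube_rep_D1.
split; [exact: minuscule_system_D | exact: minuscule_system_D
  | exact: simple_system_D |].
have [rhop rhopP] := half_cube_rep_D R hn false.
have [rhom rhomP] := half_cube_rep_D R hn true.
have topE : half_cube_top R n false = 2 *: jvec R n.
  by rewrite /half_cube_top scale0r subr0.
have botF : - half_cube_top R n false = -2 *: jvec R n.
  by rewrite topE scaleNr.
have botT : - half_cube_top R n true = -2 *: jvec R n + 4 *: eps R n (n - 1).
  by rewrite /half_cube_top opprB addrC scaleNr.
have maxP e := half_cube_sole_maximal R hn e.
have minP e := half_cube_sole_minimal R hn e.
have htP := half_cube_height_gt0 R hn.
have aff e (rho : lie_rep (kac_moody R[i] (cartan_D n))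
                          (VPsi (half_cube R n e))) :
    acts_by_operators rho (node_D R n) ->
    affords_L rho (@fund_weight _ n (if e then n - 1 else n)%N).
  move=> rhoP; apply: (sole_maximal_affords (maxP e) htP rhoP) => i.
  by rewrite wcoef_half_cube_top // /fund_weight; case: (_ == _).
exists rhop, rhom; split=> //.
- have h1 : (n - 1 < n)%N by lia.
  apply: (nonisomorphic_of_tops (i := Ordinal h1) (maxP false) (maxP true))
    => //.
  rewrite !wcoef_half_cube_top // /fund_weight /=.
  have -> : ((n - 1).+1 == n) by lia.
  have -> : ((n - 1).+1 == n - 1)%N = false by lia.
  exact: oner_neq0.
- split; [exact: (sole_maximal_irreducible (maxP false) htP rhopP)|].
  exact: (sole_maximal_irreducible (maxP true) htP rhomP).
- by left; split; [exact: (aff false)|exact: (aff true)].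
- split=> x.
  + by rewrite -topE; apply: (highest_weight_vectorP (maxP false) rhopP).
  + exact: (highest_weight_vectorP (maxP true) rhomP).
  + have := lowest_weight_vectorP x (minP false) rhopP.
    by rewrite /half_cube_bottom addbF; case: (odd n); rewrite ?botT ?botF.
  + have := lowest_weight_vectorP x (minP true) rhomP.
    by rewrite /half_cube_bottom addbT; case: (odd n); rewrite /= ?botT ?botF.
Qed.
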